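(* Let $r\in L_2(\eta_0)$ and $\phi(\eta_0)=\mathbb{E}_{\eta_0}[r(\alpha)]$ (UH is not required to be nonparametric). If $\phi(\eta_0)$ is regularly identified, then $$\Pi_{\overline{T(\eta_0)}}r(\alpha)=\Pi_{\overline{T(\eta_0)}}\mathbb{E}[s(Z)\mid\alpha]\quad\text{for some }s\in L_2^0(\mathbb{P}).$$
   Context: Setting: $Z$ is observed; $\alpha$ (unobserved heterogeneity, UH) is unobserved with unknown distribution $\eta_0$ belonging to a class $H$ of distributions on $\mathcal{A}\subseteq\mathbb{R}^{d_\alpha}$. $Z$ has law $\mathbb{P}$ with density $f_{\eta_0}(z)=\int_{\mathcal{A}}f_{z/\alpha}(z)\,d\eta_0(\alpha)$ with respect to a $\sigma$-finite measure $\mu$, where $f_{z/\alpha}$ is the known conditional density of $Z$ given $\alpha$; thus $\mathbb{E}[s(Z)\mid\alpha]=\int s(z)f_{z/\alpha}(z)d\mu(z)$. $L_2^0(\nu)$ denotes zero-$\nu$-mean functions in $L_2(\nu)$. A path $\eta_t\in H$, $t\in[0,\varepsilon)$, has score $b\in L_2(\eta_0)$ if $\int[(d\eta_t^{1/2}-d\eta_0^{1/2})/t-\tfrac12 b\,d\eta_0^{1/2}]^2\to0$ as $t\downarrow0$. $T(\eta_0)$ is the linear span of all such scores; $\overline{T(\eta_0)}$ is its closure in $L_2(\eta_0)$, and $\Pi_{\overline{T(\eta_0)}}$ the orthogonal projection onto it. UH is nonparametric if $\overline{T(\eta_0)}=L_2^0(\eta_0)$. Regular identification: the score operator is $Ab=\mathbb{E}[b(\alpha)\mid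 Z]$, $b\in T(\eta_0)$. For $\phi(\eta)=\mathbb{E}_\eta[r(\alpha)]$, the derivative along a path with score $b$ is $\mathbb{E}_{\eta_0}[r(\alpha)b(\alpha)]$, and the efficiency bound is $\sup_{b\in T(\eta_0)}(\mathbb{E}_{\eta_0}[rb])^2/\mathbb{E}[(Ab(Z))^2]$ (with $0/0=0$, $c/0=\infty$ for $c>0$). $\phi(\eta_0)$ is regularly identified if it is identified ($f_\eta=f_{\eta_0}$ $\mu$-a.e., $\eta\in H$, implies $\phi(\eta)=\phi(\eta_0)$) with a finite efficiency bound. *)

(* Defs.v *)
From HB Require Import structures.
From mathcomp Require Import all_boot all_order all_algebra.
From mathcomp Require Import all_classical all_reals all_analysis.

Set Implicit Arguments.
Unset Strict Implicit.
Unset Printing Implicit Defensive.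
Import Order.TTheory GRing.Theory Num.Theory.
Import numFieldNormedType.Exports.
Local Open Scope classical_set_scope.
Local Open Scope ring_scope.

Section L2.
Context d (T : measurableType d) (R : realType).

Definition L2_zero_mean (P : probability T R) : set (T -> R) :=
  [set s | s \in Lfun P 2%:E /\ ('E_P[s] = 0)%E].

Definition lin_span (S : set (T -> R)) : set (T -> R) :=
  [set b | exists n (c : 'I_n -> R) (s : 'I_n -> T -> R),
     (forall i, S (s i)) /\ b = (fun x => \sum_(i < n) c i * s i x)].

Definition L2_closure (P : probability T R) (V : set (T -> R)) :
    set (T -> R) :=
  [set b | b \in Lfun P 2%:E /\
     forall e : R, 0 < e ->
       exists2 v, V v & ('N[P]_2%:E[EFin \o (b \- v)%R] < e%:E)%E].

(* [p] is (a version of) the orthogonal projection of [h] in L2(P) onto the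
   closed subspace [M]: it lies in [M] and the residual is orthogonal to [M].
   Elements of L2(P) are represented by functions, so [p] is only determined
   P-almost everywhere. *)
Definition is_L2_proj (P : probability T R) (M : set (T -> R))
    (h p : T -> R) : Prop :=
  [/\ h \in Lfun P 2%:E, M p &
      forall v, M v -> ('E_P[((h \- p) \* v)%R] = 0)%E].

End L2.

Section dominating.
Context d (T : measurableType d) (R : realType).
Variables (eta eta' : probability T R).

Definition dominating : set T -> \bar R := measure_add eta eta'.

HB.instance Definition _ := Measure.on dominating.

Let dominating_finite : fin_num_fun dominating.
Proof.
move=> A mA; rewrite /dominating measure_addE fin_numD.
by rewrite !fin_num_measure.
Qed.

HB.instance Definition _ :=
  @Measure_isFinite.Build _ _ _ dominating dominating_finite.

End dominating.

Section scores.
Context d (T : measurableType d) (R : realType).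
Implicit Types (eta : probability T R) (b : T -> R).

Definition sqrt_density (nu : probability T R)
    (la : {sigma_finite_measure set T -> \bar R}) (x : T) : R :=
  Num.sqrt (fine (Radon_Nikodym (charge_of_finite_measure nu) la x)).

(* int [(deta^{1/2} - deta0^{1/2}) / t - 1/2 b deta0^{1/2}]^2, computed with
   densities with respect to eta + eta0; the value does not depend on the
   choice of the dominating measure. *)
Definition hellinger_remainder eta0 eta (t : R) b : \bar R :=
  let la := dominating eta eta0 in
  (\int[la]_x
    (((sqrt_density eta la x - sqrt_density eta0 la x) / t
      - 2^-1 * b x * sqrt_density eta0 la x) ^+ 2)%:E)%E.

Definition is_score (H : set (probability T R)) eta0 b : Prop :=
  b \in Lfun eta0 2%:E /\
  exists (e : R) (path : R -> probability T R),
    [/\ 0 < e,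
        forall t, 0 <= t < e -> H (path t),
        path 0 = eta0 &
        hellinger_remainder eta0 (path t) t b @[t --> 0^'+] --> 0%E].

Definition tangent_space (H : set (probability T R)) eta0 : set (T -> R) :=
  lin_span (is_score H eta0).

Definition closed_tangent_space (H : set (probability T R)) eta0 :
    set (T -> R) :=
  L2_closure eta0 (tangent_space H eta0).

End scores.

Section model.
Context d (Z : measurableType d) d' (T : measurableType d') (R : realType).
Variables (mu : {sigma_finite_measure set Z -> \bar R}) (A : set T).
(* [f a z] is the conditional density of Z at z given alpha = a; only its
   values for [a] in the support [A] are meaningful. *)
Variable f : T -> Z -> R.

Definition cond_density : Prop :=
  measurable_fun (setT `*` A) (fun x : Z * T => f x.2 x.1) /\
  forall a, A a ->
    (forall z, 0 <= f a z) /\ (\int[mu]_z (f a z)%:E = 1)%E.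

Definition mixture_density (eta : probability T R) (z : Z) : \bar R :=
  (\int[eta]_(a in A) (f a z)%:E)%E.

Definition has_mixture_law (eta : probability T R) (P : probability Z R) :
    Prop :=
  forall B, measurable B ->
    P B = (\int[mu]_(z in B) mixture_density eta z)%E.

(* E[s(Z) | alpha = a], set to 0 off the support *)
Definition cond_mean (s : Z -> R) : T -> R :=
  (fun a => \int[mu]_z (s z * f a z)) \_ A.

(* [g] is a version of the conditional expectation E[b(alpha) | Z], i.e.
   E[g(Z) 1_B(Z)] = E[b(alpha) 1_B(Z)] for all measurable B, where (Z, alpha)
   has density f with respect to mu \x eta0. *)
Definition is_score_operator (eta0 : probability T R) (P : probability Z R)
    (b : T -> R) (g : Z -> R) : Prop :=
  g \in Lfun P 1%:E /\
  forall B, measurable B ->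
    (\int[P]_(z in B) (g z)%:E =
     \int[mu \x eta0]_(x in B `*` A) (b x.2 * f x.2 x.1)%:E)%E.

(* In [\bar R], 0^-1 = +oo and 0 * +oo = 0; hence the quotient below follows
   the conventions 0 / 0 = 0 and c / 0 = +oo for c > 0. *)
Definition efficiency_bound (H : set (probability T R))
    (eta0 : probability T R) (P : probability Z R) (r : T -> R) : \bar R :=
  ereal_sup [set q : \bar R | exists b g,
    [/\ tangent_space H eta0 b,
        is_score_operator eta0 P b g &
        q = ('E_eta0[(r \* b)%R] ^+ 2 / 'E_P[(g \* g)%R])%E]].

(* The equality of expectations is in [\bar R]. For eta = eta0 and r in
   L2(eta0) the expectation is finite, and an ill-defined integral
   (+oo - +oo) is valued -oo, so the equality entails that E_eta[r] is
   well-defined. *)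
Definition identified (H : set (probability T R)) (eta0 : probability T R)
    (r : T -> R) : Prop :=
  forall eta, H eta ->
    {ae mu, forall z, mixture_density eta z = mixture_density eta0 z} ->
    ('E_eta[r] = 'E_eta0[r])%E.

Definition regularly_identified (H : set (probability T R))
    (eta0 : probability T R) (P : probability Z R) (r : T -> R) : Prop :=
  identified H eta0 r /\ (efficiency_bound H eta0 P r < +oo)%E.

End model.

(* Main.v *)
(** Write S for the score operator and C for the efficiency bound. Finiteness of
    C says that (E[r b])^2 <= C E[(S b)^2] for every b in the tangent space, so
    S b |-> E[r b] is a well-defined bounded linear functional on the range of
    S. By Riesz it is represented by some s in L2(P), and by Fubini
    E[s(Z) S b(Z)] = E[E[s(Z) | alpha] b(alpha)]. Hence r and E[s(Z) | alpha]
    have the same inner product with every tangent b, hence the same projection.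
    Scores have mean zero, so s can be recentred without changing these inner
    products. The score operator itself is obtained as an adjoint, again by
    Riesz, which avoids dividing by the mixture density. *)

Require Import Defs.
From mathcomp Require Import all_boot all_order all_algebra.
From mathcomp Require Import all_classical all_reals all_analysis.
From mathcomp Require Import measurable_realfun ring lra.
Set Implicit Arguments.
Unset Strict Implicit.
Unset Printing Implicit Defensive.
Import Order.TTheory GRing.Theory Num.Theory.
Import numFieldNormedType.Exports.
Local Open Scope classical_set_scope.
Local Open Scope ring_scope.

(** * The inner product of L2 *)

Section L2_inner.
Context d (T : measurableType d) (R : realType).
Variable mu : {measure set T -> \bar R}.
Implicit Types (f g h : T -> R) (c : R).

Definition L2_inner f g : R := \int[mu]_x (f x * g x).

Local Notation L2 := (Lfun mu 2%:E).
Local Notation ip := L2_inner.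

Lemma Lfun2P f : f \in L2 <->
  measurable_fun setT f /\ (\int[mu]_x (f x ^+ 2)%:E < +oo)%E.
Proof.
split => [fL|[mf fi]].
  split; first by case/andP: fL; rewrite inE.
  move/Lfun2_integrable_sqr/integrableP: fL => [_].
  by under eq_integral do rewrite /= ger0_norm ?sqr_ge0//.
rewrite inE; apply/andP; split; rewrite inE//= /finite_norm unlock /=.
rewrite poweR_lty//; apply: le_lt_trans fi.
by under eq_integral do rewrite /= powR_mulrn// -normrX ger0_norm ?sqr_ge0//.
Qed.

Lemma Lfun2_measurable f : f \in L2 -> measurable_fun setT f.
Proof. by case/Lfun2P. Qed.

Lemma Lfun2_mul_integrable f g : f \in L2 -> g \in L2 ->
  mu.-integrable setT (fun x => (f x * g x)%:E).
Proof. by move=> fL gL; exact/Lfun1_integrable/Lfun2_mul_Lfun1. Qed.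

Lemma Lfun2_le f (g : T -> R) : measurable_fun setT f -> g \in L2 ->
  (forall x, `|f x| <= `|g x|) -> f \in L2.
Proof.
move=> mf /Lfun2P[mg gi] fg; apply/Lfun2P; split => //.
apply: le_lt_trans gi; apply: ge0_le_integral => //.
- by move=> x _; rewrite lee_fin sqr_ge0.
- by apply/measurable_EFinP; exact: measurable_funX.
- by apply/measurable_EFinP; exact: measurable_funX.
- by move=> x _; rewrite lee_fin -[leLHS]ger0_norm ?sqr_ge0//
    -[leRHS]ger0_norm ?sqr_ge0// !normrX lerXn2r// nnegrE.
Qed.

Lemma Lfun2Z c f : f \in L2 -> (fun x => c * f x) \in L2.
Proof.
move=> fL; have -> : (fun x => c * f x) = c \o* f.
  by apply/funext => x /=; rewrite mulrC.
by apply: Lfun_scale => //; rewrite ler1n.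
Qed.

Lemma Lfun2D f g : f \in L2 -> g \in L2 -> (fun x => f x + g x) \in L2.
Proof.
move=> fL gL; move: (Lfun2P f).1 => /(_ fL)[mf fi].
move: (Lfun2P g).1 => /(_ gL)[mg gi]; apply/Lfun2P; split.
  exact: measurable_funD.
(* The square of the sum is dominated by 2 f^2 + 2 g^2. *)
have ig : mu.-integrable setT (fun x => (2 * (f x * f x) + 2 * (g x * g x))%:E).
  under eq_fun do rewrite EFinD !EFinM.
  apply: integrableD => //; (apply: integrableZl => //;
    exact: Lfun2_mul_integrable).
move/integrableP: ig => [mi]; apply: le_lt_trans.
apply: ge0_le_integral => //.
- by move=> x _; rewrite lee_fin sqr_ge0.
- by apply/measurable_EFinP/measurable_funX/measurable_funD.
- exact: measurableT_comp.
- move=> x _; rewrite /= lee_fin; apply: le_trans (ler_norm _).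
  by have := sqr_ge0 (f x - g x); rewrite !expr2; nra.
Qed.

Lemma Lfun2B f g : f \in L2 -> g \in L2 -> (fun x => f x - g x) \in L2.
Proof.
move=> fL gL; have -> : (fun x => f x - g x) = (fun x => f x + -1 * g x).
  by apply/funext => x; rewrite mulN1r.
by apply: Lfun2D => //; exact: Lfun2Z.
Qed.

Lemma Lfun2_0 : (fun=> 0 : R) \in L2.
Proof.
apply/Lfun2P; split; first exact: measurable_cst.
by under eq_integral do rewrite expr0n; rewrite integral0.
Qed.

Lemma L2_innerE f g : f \in L2 -> g \in L2 ->
  (\int[mu]_x (f x * g x)%:E)%E = (ip f g)%:E.
Proof.
move=> fL gL; rewrite /L2_inner /Rintegral fineK//.
by apply: integrable_fin_num => //; exact: Lfun2_mul_integrable.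
Qed.

Lemma L2_innerC f g : (ip f g) = (ip g f).
Proof. by apply: eq_Rintegral => x _; rewrite mulrC. Qed.

Lemma L2_innerDl f g h : f \in L2 -> g \in L2 -> h \in L2 ->
  (ip (fun x => f x + g x) h) = (ip f h) + (ip g h).
Proof.
move=> fL gL hL; rewrite -RintegralD//; try exact: Lfun2_mul_integrable.
by apply: eq_Rintegral => x _; rewrite mulrDl.
Qed.

Lemma L2_innerZl c f h : f \in L2 -> h \in L2 ->
  (ip (fun x => c * f x) h) = c * (ip f h).
Proof.
move=> fL hL; rewrite -RintegralZl//; last exact: Lfun2_mul_integrable.
by apply: eq_Rintegral => x _; rewrite mulrA.
Qed.

Lemma L2_innerBl f g h : f \in L2 -> g \in L2 -> h \in L2 ->
  (ip (fun x => f x - g x) h) = (ip f h) - (ip g h).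
Proof.
move=> fL gL hL; rewrite -RintegralB//; try exact: Lfun2_mul_integrable.
by apply: eq_Rintegral => x _; rewrite mulrBl.
Qed.

Lemma L2_inner_ge0 f : 0 <= (ip f f).
Proof. by apply: Rintegral_ge0 => x _; rewrite -expr2 sqr_ge0. Qed.

Lemma L2_inner_sqD f g c : f \in L2 -> g \in L2 ->
  (ip (fun x => f x + c * g x) (fun x => f x + c * g x)) =
  (ip f f) + 2 * c * (ip f g) + c ^+ 2 * (ip g g).
Proof.
move=> fL gL; have cgL := Lfun2Z c gL.
rewrite L2_innerDl//; last exact: Lfun2D.
rewrite L2_innerC L2_innerDl// (L2_innerC _ (fun x => f x + _)) L2_innerDl//.
rewrite (L2_innerC f (fun x => c * g x)) !L2_innerZl//.
rewrite (L2_innerC g (fun x => c * g x)) !L2_innerZl//.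
by rewrite (L2_innerC g f); ring.
Qed.

Lemma L2_inner_sqB f g : f \in L2 -> g \in L2 ->
  (ip (fun x => f x - g x) (fun x => f x - g x)) =
  (ip f f) - 2 * (ip f g) + (ip g g).
Proof.
move=> fL gL; have := L2_inner_sqD (-1) fL gL.
under [fun x => f x + -1 * g x]eq_fun do rewrite mulN1r.
by move=> ->; ring.
Qed.

(** A quadratic that never becomes negative has nonpositive discriminant, here 4 (b^2 - a c). It
    yields both Cauchy-Schwarz and the approximate first-order condition in the Riesz argument. *)
Lemma quadratic_ge0_discr (a b c : R) :
  (forall t, 0 <= c + 2 * t * b + t ^+ 2 * a) -> b ^+ 2 <= a * c.
Proof.
move=> H; pose p := Poly [:: c; 2 * b; a].
have := @deg_le2_poly_ge0 R p (size_Poly _).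
have -> : p`_2 = a by rewrite !coefE.
have -> : p`_1 = 2 * b by rewrite !coefE.
have -> : p`_0 = c by rewrite !coefE.
have hp t : 0 <= p.[t].
  by rewrite horner_Poly/=; have := H t; lra.
by move=> /(_ hp); nra.
Qed.

Lemma Cauchy_Schwarz f g : f \in L2 -> g \in L2 ->
  (ip f g) ^+ 2 <= (ip f f) * (ip g g).
Proof.
move=> fL gL; rewrite mulrC; apply: quadratic_ge0_discr => t.
by rewrite -L2_inner_sqD// L2_inner_ge0.
Qed.

Lemma Lnorm2E f : f \in L2 ->
  'N[mu]_2%:E[EFin \o f]%E = (Num.sqrt (ip f f))%:E.
Proof.
move=> fL; rewrite unlock /=.
under eq_integral do rewrite powR_mulrn// -normrX ger0_norm ?sqr_ge0// expr2.
by rewrite L2_innerE// poweR12_sqrt ?lee_fin ?L2_inner_ge0.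
Qed.

End L2_inner.

(** * Completeness, Riesz representation and projections *)

Section L2_complete.
Context d (T : measurableType d) (R : realType).
Variable mu : {measure set T -> \bar R}.

Local Notation L2 := (Lfun mu 2%:E).
Local Notation ip := (L2_inner mu).

(** Telescoping turns the sequence into a series that converges absolutely by comparison with a
    geometric one. *)
Lemma cvgn_geometric_increments (u : R^nat) (K : R) :
  (forall k, `|u k.+1 - u k| <= K * 2^-1 ^+ k) -> cvgn u.
Proof.
move=> uK; set v := fun k => u k.+1 - u k.
have uE : u = (fun n => u 0%N + series v n).
  apply/funext => n; rewrite /series/= /v telescope_sumr// addrC subrK//.
rewrite uE; apply: is_cvgD; first exact: is_cvg_cst.
apply: normed_cvg; apply: (@series_le_cvg _ _ (geometric K 2^-1)).
- by move=> n; exact: normr_ge0.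
- by move=> n; rewrite /geometric/=; apply: le_trans (uK n).
- exact: uK.
- by apply: is_cvg_geometric_series; rewrite ger0_norm// invf_lt1// ltr1n.
Qed.

Lemma limn_einf_le (u : (\bar R)^nat) (M : \bar R) :
  (forall n, (u n <= M)%E) -> (limn_einf u <= M)%E.
Proof.
move=> uM; rewrite limn_einf_lim; apply: lime_le; first exact: is_cvg_einfs.
apply: nearW => n; apply: le_trans (uM n).
by apply: ereal_inf_lbound; exists n => /=.
Qed.

Lemma nneseries_geometric_lty (C : R) : 0 <= C ->
  (\sum_(k <oo) (C * 4^-1 ^+ k)%:E < +oo)%E.
Proof.
move=> C0; apply: (@le_lt_trans _ _ (2 * C)%:E); last exact: ltry.
apply: lime_le.
  by apply: is_cvg_nneseries => n _ _; rewrite lee_fin mulr_ge0// exprn_ge0.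
apply: nearW => n; rewrite sumEFin lee_fin.
(* The constant 2 exceeds the exact 4/3; the slack lets the induction close by [nra]. *)
apply: (@le_trans _ _ (2 * C * (1 - 4^-1 ^+ n))).
  elim: n => [|n ih]; first by rewrite big_geq// expr0 subrr mulr0.
  rewrite big_nat_recr//=; apply: (le_trans (lerD ih (lexx _))).
  have : 0 <= (4^-1 : R) ^+ n by rewrite exprn_ge0.
  by rewrite exprS; set q := _ ^+ n; nra.
have : 0 <= (4^-1 : R) ^+ n by rewrite exprn_ge0.
by set q := _ ^+ n; nra.
Qed.

(** Riesz-Fischer for a sequence with a geometric Cauchy rate: the rate gives convergence almost
    everywhere without extracting a subsequence, and Fatou carries the rate over to the limit. *)
Lemma L2_complete (u : nat -> T -> R) (C : R) :
  (forall n, u n \in L2) ->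
  (forall n m, (n <= m)%N ->
    ip (fun x => u n x - u m x) (fun x => u n x - u m x) <= C * 16^-1 ^+ n) ->
  exists2 f, f \in L2 &
    forall n, ip (fun x => u n x - f x) (fun x => u n x - f x) <=
      C * 16^-1 ^+ n.
Proof.
move=> uL uC.
have mu_ n : measurable_fun setT (u n) by exact: Lfun2_measurable.
have C0 : 0 <= C.
  by have := uC 0%N 0%N isT; rewrite expr0 mulr1; apply: le_trans; exact: L2_inner_ge0.
(* The weight 4^k splits the rate 16^-k: the integrals of [e k] are at most C 4^-k, hence summable,
   while finiteness of the sum at a point forces increments of order 2^-k there. *)
pose e k x : \bar R := (4 ^+ k * (u k x - u k.+1 x) ^+ 2)%:E.
have e0 k x : (0 <= e k x)%E by rewrite lee_fin mulr_ge0 ?sqr_ge0 ?exprn_ge0.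
have me k : measurable_fun setT (e k).
  by apply/measurable_EFinP/measurable_funM => //; exact/measurable_funX/measurable_funB.
pose S x := (\sum_(k <oo) e k x)%E.
have mS : measurable_fun setT S.
  by apply: ge0_emeasurable_sum => // k x _ _; exact: e0.
have S0 x : (0 <= S x)%E by apply: nneseries_ge0 => k _ _.
have Sint : mu.-integrable setT S.
  apply/integrableP; split => //.
  under eq_integral do rewrite gee0_abs//.
  rewrite integral_nneseries//.
  apply: le_lt_trans (nneseries_geometric_lty C0).
  apply: lee_nneseries => k _; first by move=> _; exact: integral_ge0.
  rewrite /e; under eq_integral do rewrite EFinM expr2.
  rewrite ge0_integralZl//; last 2 first.
  - by apply/measurable_EFinP/measurable_funM; exact/measurable_funB.
  - by move=> x _; rewrite lee_fin -expr2 sqr_ge0.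
  rewrite L2_innerE ?Lfun2B// -EFinM lee_fin.
  apply: (@le_trans _ _ (4 ^+ k * (C * 16^-1 ^+ k))).
    by rewrite ler_pM2l ?exprn_gt0//; exact: uC.
  rewrite mulrCA -exprMn le_eqVlt; apply/orP; left; apply/eqP.
  by congr (_ * _ ^+ _); field.
pose D := [set x | S x \is a fin_num].
have mD : measurable D.
  by rewrite -[D]setTI; exact: emeasurable_fin_num.
have aeD : {ae mu, forall x, D x}.
  by have := integrable_ae measurableT Sint; apply: filterS => x; exact.
(* Outside [D], whose complement is null, the sequence is set to 0, so that the limit exists at
   every point and is measurable. *)
pose v n x := u n x * \1_D x.
have mv n : measurable_fun setT (v n) by apply: measurable_funM.
have cv x : cvgn (v ^~ x).
  have [Dx|nDx] := pselect (D x); last first.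
    rewrite /v indicE memNset// (_ : (fun _ => _) = cst 0).
      exact: is_cvg_cst.
    by apply/funext => n; rewrite mulr0.
  (* With y = 2^k times the increment, y^2 <= S x; the bound |y| <= 1 + y^2 then avoids a square
     root. *)
  apply: (@cvgn_geometric_increments _ (1 + fine (S x))) => k.
  rewrite /v indicE mem_set// !mulr1 distrC.
  have : (e k x <= S x)%E.
    apply: le_trans (nneseries_lim_ge k.+1 _); last by move=> *; exact: e0.
    by rewrite big_nat_recr//= leeDr// sume_ge0.
  rewrite -(fineK Dx) lee_fin => ekx.
  rewrite exprVn ler_pdivlMr ?exprn_gt0//.
  rewrite -[X in _ * X]ger0_norm ?exprn_ge0// -normrM.
  move: ekx; have -> : (4 : R) ^+ k = (2 ^+ k) ^+ 2.
    by rewrite -exprM mulnC exprM; congr (_ ^+ _); ring.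
  rewrite -exprMn mulrC; set y := _ * _ => ekx.
  by have := sqr_ge0 (`|y| - 1); rewrite -real_normK ?num_real// in ekx; nra.
pose f x := limn (v ^~ x).
have vf x : v ^~ x @ \oo --> f x by exact: cv.
have mf : measurable_fun setT f by apply: (measurable_fun_cvg mv) => x _.
(* Fatou in m, applied to the squares of u n - u (n + m), which tend to that of u n - f at every
   point of [D]. *)
have fC n : (\int[mu]_x ((u n x - f x) ^+ 2)%:E <= (C * 16^-1 ^+ n)%:E)%E.
  pose h m x : \bar R := ((u n x - u (n + m)%N x) ^+ 2)%:E.
  have mh m : measurable_fun setT (h m).
    by apply/measurable_EFinP; exact/measurable_funX/measurable_funB.
  have h0 m x : (0 <= h m x)%E by rewrite lee_fin sqr_ge0.
  apply: (@le_trans _ _ (\int[mu]_x limn_einf (h ^~ x))%E).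
    apply: ae_ge0_le_integral => //.
    - by move=> x _; rewrite lee_fin sqr_ge0.
    - by apply/measurable_EFinP; exact/measurable_funX/measurable_funB.
    - move=> x _; rewrite limn_einf_lim; apply: lime_ge.
        exact: is_cvg_einfs.
      by apply: nearW => m; apply: le_ereal_inf_tmp => _ [k _ <-].
    - under eq_fun do rewrite limn_einf_lim.
      apply: (emeasurable_fun_cvg (fun k x => einfs (h ^~ x) k)).
        by move=> k; exact: measurable_fun_einfs.
      by move=> x _; exact: is_cvg_einfs.
    apply: filterS aeD => x Dx _.
    suff : h ^~ x @ \oo --> ((u n x - f x) ^+ 2)%:E.
      by move/cvg_limn_einf_sup => [-> _].
    apply: cvg_EFin; first by apply: nearW.
    suff ucv : (fun m => u n x - u (n + m)%N x) @ \oo --> u n x - f x.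
      by rewrite expr2; exact: (cvgM ucv ucv).
    apply: cvgB; first exact: cvg_cst.
    have := vf x; rewrite -(cvg_shiftn n)/= /v indicE mem_set//.
    by under eq_fun do rewrite mulr1 addnC.
  apply: (le_trans (fatou _ _ _ _)) => //.
  apply: limn_einf_le => m; rewrite /h.
  under eq_integral do rewrite expr2.
  by rewrite L2_innerE ?Lfun2B// lee_fin uC// leq_addr.
have ufL n : (fun x => u n x - f x) \in L2.
  apply/Lfun2P; split; first exact: measurable_funB.
  exact: le_lt_trans (fC n) (ltry _).
exists f.
  have -> : f = (fun x => u 0%N x - (u 0%N x - f x)).
    by apply/funext => x; rewrite opprB addrC subrK.
  exact: Lfun2B.
move=> n; rewrite -lee_fin -L2_innerE//.
by apply: le_trans (fC n); under eq_integral do rewrite -expr2.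
Qed.

End L2_complete.

(** * Riesz representation by minimising a quadratic energy *)

Section Riesz.
Context d (T : measurableType d) (R : realType).
Variable mu : {measure set T -> \bar R}.

Local Notation L2 := (Lfun mu 2%:E).
Local Notation ip := (L2_inner mu).

(* A linear functional on a subspace of L2, given by its graph. Working with
   graphs avoids choosing a.e.-representatives that depend linearly on their
   class. *)
Definition linear_graph (G : (T -> R) -> R -> Prop) : Prop :=
  [/\ forall f x, G f x -> f \in L2,
      G (fun=> 0) 0 &
      forall c f x g y, G f x -> G g y ->
        G (fun t => f t + c * g t) (x + c * y)].

Section bounded_graph.
Variables (G : (T -> R) -> R -> Prop) (C : R).
Hypotheses (C0 : 0 <= C) (linG : linear_graph G)
  (bndG : forall f x, G f x -> x ^+ 2 <= C * ip f f).

(** If the functional is represented by p, so that x = <p, f>, this energy is |f - p|^2 - |p|^2.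
    Minimising it therefore means approaching p. *)
Let J f x := ip f f - 2 * x.

(** With n = |f|^2, otherwise 2 x > C + n >= 0, hence 4 x^2 > (C + n)^2 >= 4 C n, against the bound
    on x^2. *)
Let J_bounded f x : G f x -> - C <= J f x.
Proof.
move=> fx; have := bndG fx; have := L2_inner_ge0 mu f; rewrite /J.
set n := ip f f => n0 xn.
have [|Cn] := leP 0 (C + n - 2 * x); first lra.
have := sqr_ge0 (C - n); have : 0 < (2 * x - (C + n)) * (2 * x + (C + n)).
  by rewrite mulr_gt0//; move: C0; lra.
by move: C0; nra.
Qed.

Let energies := [set j | exists f x, G f x /\ j = J f x].

Let m := inf energies.

Let has_inf_energies : has_inf energies.
Proof.
case: linG => _ G0 _; split; first by exists (J (fun=> 0) 0), (fun=> 0), 0.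
by exists (- C) => _ [f [x [fx ->]]]; exact: J_bounded.
Qed.

Let J_ge_inf f x : G f x -> m <= J f x.
Proof.
by move=> fx; apply: ge_inf; [case: has_inf_energies | exists f, x].
Qed.

(** The energy at f + t g, expanded in t: near the infimum, nonnegativity of this quadratic controls
    its linear coefficient <f, g> - y. *)
Let J_var t f x g y : G f x -> G g y ->
  m <= J f x + 2 * t * (ip f g - y) + t ^+ 2 * ip g g.
Proof.
case: linG => GL _ Gl fx gy; have := J_ge_inf (Gl t _ _ _ _ fx gy).
by rewrite /J L2_inner_sqD ?(GL _ _ fx) ?(GL _ _ gy)//; lra.
Qed.

(** Parallelogram law: |f - g|^2 = 2 J f + 2 J g - 4 J ((f + g) / 2), and the midpoint has energy at
    least m. *)
Let J_cauchy f x g y a b : G f x -> G g y -> J f x <= m + a -> J g y <= m + b ->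
  ip (fun t => f t - g t) (fun t => f t - g t) <= 2 * a + 2 * b.
Proof.
case: linG => GL _ Gl fx gy fa gb.
have fL := GL _ _ fx; have gL := GL _ _ gy.
pose h := fun t => f t + 1 * g t.
have Gh : G h (x + 1 * y) by exact: Gl.
have hL := GL _ _ Gh.
(* The midpoint is written h - h / 2, because the only closure operation of the graph is f + c g. *)
have := J_ge_inf (Gl (- 2^-1) _ _ _ _ Gh Gh).
rewrite /J (L2_inner_sqD _ hL hL) (L2_inner_sqD 1 fL gL).
rewrite L2_inner_sqB//.
by move: fa gb; rewrite /J; nra.
Qed.

(** The vector p is the limit of a minimising sequence. That p is approximated from the domain of
    the graph is recorded as well, since this makes p a projection when the functional is an inner
    product. Single-valuedness of the graph need not be assumed: it follows from the bound. *)
Lemma bounded_graph_Riesz : exists2 p, p \in L2 &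
  (forall e, 0 < e -> exists f x, G f x /\
     ip (fun t => f t - p t) (fun t => f t - p t) < e) /\
  (forall f x, G f x -> ip p f = x).
Proof.
case: (linG) => GL _ Gl.
have /choice[fx Hfx] n : exists fx : (T -> R) * R,
    G fx.1 fx.2 /\ J fx.1 fx.2 <= m + 16^-1 ^+ n.
  have e0 : 0 < (16^-1 : R) ^+ n by rewrite exprn_gt0.
  have [_ [f [x [Gfx ->]]] Jm] := inf_adherent e0 has_inf_energies.
  by exists (f, x); split => //; exact: ltW.
have fL n : (fx n).1 \in L2 by have [/GL] := Hfx n.
have [p pL pC] : exists2 p, p \in L2 & forall n,
    ip (fun t => (fx n).1 t - p t) (fun t => (fx n).1 t - p t) <=
    4 * 16^-1 ^+ n.
  apply: L2_complete => // n k nk.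
  have [Gn Jn] := Hfx n; have [Gk Jk] := Hfx k.
  apply: le_trans (J_cauchy Gn Gk Jn Jk) _.
  have : (16^-1 : R) ^+ k <= 16^-1 ^+ n.
    by rewrite ler_wiXn2l// invf_le1// ler1n.
  lra.
have small (K : R) e : 0 < e -> exists n, K * 16^-1 ^+ n < e.
  move=> e0.
  have : (fun n => K * (16^-1 : R) ^+ n) @ \oo --> (0 : R).
    by rewrite -[0](mulr0 K); apply: cvgMr; apply: cvg_expr;
      rewrite ger0_norm// invf_lt1// ltr1n.
  by move/cvgr_lt => /(_ _ e0) [N _ HN]; exists N; exact: (HN N (leqnn N)).
exists p => //; split.
  move=> e e0; have [n ne] := small 4 e e0.
  exists (fx n).1, (fx n).2; split; first by have [] := Hfx n.
  exact: le_lt_trans (pC n) ne.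
move=> h y Ghy; have hL := GL _ _ Ghy.
apply/eqP; rewrite -subr_eq0 -sqrf_eq0; apply/eqP/le_anti.
rewrite sqr_ge0 andbT; apply/ler_addgt0Pl => e e0; rewrite addr0.
(* Write f_n for the minimising sequence, q = 16^-n and k = |h|^2. Then (<f_n, h> - y)^2 <= k q and
   <f_n - p, h>^2 <= 4 k q, so (<p, h> - y)^2 <= 2 k q + 8 k q = 10 k q. *)
have [n ne] := small (10 * ip h h) e e0.
apply: ltW; apply: le_lt_trans ne.
have [Gn Jn] := Hfx n.
(* Approximate stationarity: f_n has energy within 16^-n of the infimum, so the discriminant of the
   variation in direction h is nonpositive. *)
have h1 : (ip (fx n).1 h - y) ^+ 2 <= ip h h * 16^-1 ^+ n.
  apply: quadratic_ge0_discr => t.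
  by have := J_var t Gn Ghy; lra.
have := Cauchy_Schwarz (Lfun2B (fL n) pL) hL.
rewrite L2_innerBl//.
have := pC n; have := L2_inner_ge0 mu h.
set a := ip _ h in h1 *; set b := ip p h; set k := ip h h in h1 *.
set q := _ ^+ n in h1 *; set w := ip _ _ => k0 wq ab.
have h2 : (a - b) ^+ 2 <= 4 * k * q by nra.
by have := sqr_ge0 ((a - y) + (a - b)); nra.
Qed.

End bounded_graph.

End Riesz.

(** * Orthogonal projection onto the closure of a subspace *)

Section projection.
Context d (T : measurableType d) (R : realType).
Variable P : probability T R.

Local Notation L2 := (Lfun P 2%:E).
Local Notation ip := (L2_inner P).

Definition is_L2_subspace (V : set (T -> R)) : Prop :=
  [/\ forall f, V f -> f \in L2, V (fun=> 0) &
      forall c f g, V f -> V g -> V (fun t => f t + c * g t)].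

Lemma lin_span_subspace (S : set (T -> R)) :
  (forall f, S f -> f \in L2) -> is_L2_subspace (lin_span S).
Proof.
move=> SL; split.
- move=> _ [n [c [s [Ss ->]]]].
  elim: n c s Ss => [|n ih] c s Ss.
    by under eq_fun do rewrite big_ord0; exact: Lfun2_0.
  under eq_fun do rewrite big_ord_recl.
  apply: Lfun2D; first exact/Lfun2Z/SL.
  exact: ih.
- exists 0%N, (fun=> 0), (fun _ _ => 0); split; first by case.
  by apply/funext => x; rewrite big_ord0.
move=> a _ _ [n [c [s [Ss ->]]]] [n' [c' [s' [Ss' ->]]]].
exists (n + n')%N,
  (fun i => match fintype.split i with inl j => c j | inr k => a * c' k end),
  (fun i => match fintype.split i with inl j => s j | inr k => s' k end).
split; first by move=> i; case: fintype.split.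
apply/funext => x; rewrite big_split_ord/= mulr_sumr.
congr (_ + _); apply: eq_bigr => i _.
  by rewrite (unsplitK (inl i)).
by rewrite (unsplitK (inr i)) mulrA.
Qed.

(** The norm is the square root of the inner product, so a tolerance e becomes sqrt e in one
    direction and e^2 in the other. *)
Lemma L2_closureP (V : set (T -> R)) b : (forall f, V f -> f \in L2) ->
  L2_closure P V b <-> b \in L2 /\ forall e, 0 < e -> exists2 v, V v &
    ip (fun t => b t - v t) (fun t => b t - v t) < e.
Proof.
move=> VL; split=> -[bL bV]; split => // e e0.
  have se0 : 0 < Num.sqrt e by rewrite sqrtr_gt0.
  have [v Vv bv] := bV _ se0; exists v => //.
  have bvL := Lfun2B bL (VL _ Vv).
  by move: bv; rewrite (Lnorm2E bvL) lte_fin ltr_sqrt.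
have e20 : 0 < e ^+ 2 by rewrite exprn_gt0.
have [v Vv bv] := bV _ e20; exists v => //.
rewrite (Lnorm2E (Lfun2B bL (VL _ Vv))) lte_fin.
by rewrite -[ltRHS]gtr0_norm// -sqrtr_sqr ltr_sqrt.
Qed.

Lemma sub_L2_closure (V : set (T -> R)) : (forall f, V f -> f \in L2) ->
  V `<=` L2_closure P V.
Proof.
move=> VL v Vv; apply/L2_closureP => //; split; first exact: VL.
move=> e e0; exists v => //.
under [fun t => v t - v t]eq_fun do rewrite subrr.
by rewrite /L2_inner; under eq_Rintegral do rewrite mulr0;
  rewrite /Rintegral integral0.
Qed.

Lemma expectation_inner f g : f \in L2 -> g \in L2 ->
  ('E_P[f \* g] = (ip f g)%:E)%E.
Proof. by move=> fL gL; rewrite unlock -L2_innerE. Qed.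

(** Orthogonality to V passes to its closure by continuity of the inner product, that is, by
    Cauchy-Schwarz. *)
Lemma L2_closure_orthogonal (V : set (T -> R)) h p :
    (forall f, V f -> f \in L2) -> h \in L2 -> p \in L2 ->
    (forall v, V v -> ip h v = ip p v) ->
  forall v, L2_closure P V v -> ('E_P[((h \- p) \* v)%R] = 0)%E.
Proof.
move=> VL hL pL hp w /(L2_closureP _ VL)[wL wV].
have kL := Lfun2B hL pL.
rewrite expectation_inner//; congr EFin.
set k := (fun t => h t - p t) in kL *.
change (ip k w = 0).
apply/eqP; rewrite -sqrf_eq0; apply/eqP/le_anti; rewrite sqr_ge0 andbT.
apply/ler_addgt0Pl => e e0; rewrite addr0.
have k0 := L2_inner_ge0 P k.
(* The added 1 keeps the denominator positive when k vanishes almost everywhere. *)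
have e1 : 0 < e / (1 + ip k k) by rewrite divr_gt0// ltr_pwDl.
have [v Vv wv] := wV _ e1; have vL := VL _ Vv.
have := Cauchy_Schwarz kL (Lfun2B wL vL).
rewrite [ip k (fun t => _)]L2_innerC L2_innerBl//.
rewrite (L2_innerC P v) [ip k v]L2_innerBl// hp// subrr subr0 (L2_innerC P w).
move=> /le_trans; apply.
move: wv; rewrite ltr_pdivlMr ?ltr_pwDl//.
have := L2_inner_ge0 P (fun t => w t - v t).
by set y := ip _ _ => y0; nra.
Qed.

(** The projection is the Riesz representative of f |-> <h, f> restricted to V; the approximation
    clause of [bounded_graph_Riesz] puts it in the closure. *)
Lemma L2_proj_exists (V : set (T -> R)) h : is_L2_subspace V -> h \in L2 ->
  exists p, is_L2_proj P (L2_closure P V) h p.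
Proof.
move=> [VL V0 Vl] hL.
pose G f x := V f /\ x = ip h f.
have linG : linear_graph P G.
  split.
  - by move=> f x [/VL].
  - split => //; rewrite /L2_inner; under eq_Rintegral do rewrite mulr0.
    by rewrite /Rintegral integral0.
  - move=> c f x g y [Vf ->] [Vg ->]; split; first exact: Vl.
    have fL := VL _ Vf; have gL := VL _ Vg.
    rewrite [RHS]L2_innerC L2_innerDl ?Lfun2Z// L2_innerZl//.
    by rewrite (L2_innerC P f) (L2_innerC P g).
have bndG f x : G f x -> x ^+ 2 <= ip h h * ip f f.
  by move=> [/VL fL ->]; exact: Cauchy_Schwarz.
have [p pL [pV ph]] := bounded_graph_Riesz (L2_inner_ge0 P h) linG bndG.
exists p; split => //.
  apply/L2_closureP => //; split => // e e0.
  have [f [x [[Vf _] fp]]] := pV e e0; exists f => //.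
  have fL := VL _ Vf.
  by move: fp; rewrite !L2_inner_sqB// (L2_innerC P p); lra.
apply: L2_closure_orthogonal => // v Vv.
by rewrite (ph v (ip h v)).
Qed.

(** A projection depends only on the inner products with V, so two vectors that agree there share
    it. *)
Lemma L2_proj_eq (V : set (T -> R)) h k p :
    (forall f, V f -> f \in L2) -> k \in L2 ->
    (forall v, V v -> ip h v = ip k v) ->
  is_L2_proj P (L2_closure P V) h p -> is_L2_proj P (L2_closure P V) k p.
Proof.
move=> VL kL hk [hL pV hp]; have [pL _] := (L2_closureP _ VL).1 pV.
split => //; apply: L2_closure_orthogonal => // v Vv.
have vL := VL _ Vv; rewrite -hk//.
have := hp _ (sub_L2_closure VL Vv).
rewrite expectation_inner ?Lfun2B// => -[].
rewrite (_ : h \- p = (fun t => h t - p t))// L2_innerBl//.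
by move/eqP; rewrite subr_eq0 => /eqP.
Qed.

End projection.

(** * Scores have mean zero *)

Section sqrt_density.
Context d (T : measurableType d) (R : realType).
Variables (nu : probability T R) (la : {sigma_finite_measure set T -> \bar R}).
Hypothesis nula : nu `<< la.

Local Notation q := (sqrt_density nu la).

Lemma measurable_sqrt_density : measurable_fun setT q.
Proof.
have msqrt : measurable_fun [set: R] (@Num.sqrt R).
  by apply: continuous_measurable_fun; exact: sqrt_continuous.
apply: (measurableT_comp msqrt); exact: measurableT_comp.
Qed.

Lemma sqrt_density_change_of_variables (f : T -> R) :
  nu.-integrable setT (EFin \o f) ->
  (\int[la]_x (f x * q x ^+ 2)%:E = \int[nu]_x (f x)%:E)%E.
Proof.
move=> fi; have nula' : charge_of_finite_measure nu `<< la := nula.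
rewrite -(Radon_Nikodym_change_of_variables nula measurableT fi).
have mf : measurable_fun setT f by exact/measurable_EFinP/(measurable_int nu).
apply: ae_eq_integral => //.
- apply/measurable_EFinP/measurable_funM => //.
  by apply: measurable_funX; exact: measurable_sqrt_density.
- apply: emeasurable_funM; first exact/measurable_EFinP.
  exact: measurable_int (Radon_Nikodym_integrable nula').
(* The derivative agrees almost everywhere with a version that is nonnegative everywhere, so
   squaring its root gives it back. *)
have := ae_eq_Radon_Nikodym_SigmaFinite nula measurableT.
rewrite /ae_eq; apply: filterS => x /(_ I) E _ /=.
rewrite EFinM; congr (_ * _)%E.
rewrite /sqrt_density sqr_sqrtr; last first.
  by rewrite -E fine_ge0// Radon_Nikodym_SigmaFinite.f_ge0.
by rewrite fineK// Radon_Nikodym_fin_num.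
Qed.

Lemma sqrt_density_Lfun2 (f : T -> R) : f \in Lfun nu 2%:E ->
  (fun x => f x * q x) \in Lfun la 2%:E.
Proof.
move=> fL; have := Lfun2_integrable_sqr fL => fi.
apply/Lfun2P; split.
  apply: measurable_funM; first exact: Lfun2_measurable fL.
  exact: measurable_sqrt_density.
under eq_integral do rewrite exprMn.
rewrite (sqrt_density_change_of_variables fi).
by have /Lfun2P[] := fL.
Qed.

(** Multiplication by the root density embeds L2(nu) isometrically into L2(la), so that different
    laws can be compared in one Hilbert space. *)
Lemma sqrt_density_inner (f g : T -> R) :
  f \in Lfun nu 2%:E -> g \in Lfun nu 2%:E ->
  L2_inner la (fun x => f x * q x) (fun x => g x * q x) = L2_inner nu f g.
Proof.
move=> fL gL; apply: EFin_inj.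
rewrite -!L2_innerE//; try exact: sqrt_density_Lfun2.
rewrite -sqrt_density_change_of_variables; last exact: Lfun2_mul_integrable.
by apply: eq_integral => x _; congr EFin; ring.
Qed.

End sqrt_density.

Section score_zero_mean.
Context d (T : measurableType d) (R : realType).
Implicit Types (eta : probability T R) (b : T -> R).

(* Expand |q|^2 = |q0 + t (X + b q0 / 2)|^2, where q and q0 are unit vectors
   and X is the Hellinger remainder. *)
Lemma hellinger_remainder_mean eta0 eta (t e : R) b :
  0 < t -> 0 <= e -> b \in Lfun eta0 2%:E ->
  (hellinger_remainder eta0 eta t b <= (e ^+ 2)%:E)%E ->
  `|L2_inner eta0 b (fun=> 1)| <=
    2 * e + t * (2 * e ^+ 2 + 2^-1 * L2_inner eta0 b b).
Proof.
move=> t0 e0 bL; rewrite /hellinger_remainder.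
set la : {sigma_finite_measure set T -> \bar R} := dominating eta eta0.
have d1 : eta `<< la.
  apply/null_content_dominatesP => A mA; rewrite /= /dominating measure_addE.
  by move/eqP; rewrite padde_eq0// => /andP[/eqP].
have d0 : eta0 `<< la.
  apply/null_content_dominatesP => A mA; rewrite /= /dominating measure_addE.
  by move/eqP; rewrite padde_eq0// => /andP[_ /eqP].
have one1 : (fun=> 1) \in Lfun eta 2%:E by exact: Lfun_cst.
have one0 : (fun=> 1) \in Lfun eta0 2%:E by exact: Lfun_cst.
have := sqrt_density_inner d1 one1 one1.
have := sqrt_density_inner d0 one0 one0.
have := sqrt_density_inner d0 bL one0.
have := sqrt_density_inner d0 bL bL.
have := sqrt_density_Lfun2 d0 one0; have := sqrt_density_Lfun2 d1 one1.
have := sqrt_density_Lfun2 d0 bL.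
set q := sqrt_density eta la; set q0 := sqrt_density eta0 la.
under [fun x => 1 * q x]eq_fun do rewrite mul1r.
under [fun x => 1 * q0 x]eq_fun do rewrite mul1r.
set bq := (fun x => b x * q0 x).
have unit1 (nu : probability T R) : L2_inner nu (fun=> 1) (fun=> 1) = 1.
  rewrite /L2_inner mulr1 Rintegral_cst// mul1r.
  by have /= -> := @probability_setT _ _ _ nu.
rewrite !unit1 => bqL qL q0L bb b1 q00 qq.
set X := (fun x => (q x - q0 x) / t - 2^-1 * b x * q0 x) => Xe.
have mX : measurable_fun setT X.
  have mq := Lfun2_measurable qL; have mq0 := Lfun2_measurable q0L.
  have mb := Lfun2_measurable bL.
  by apply: measurable_funB; apply: measurable_funM => //;
    [exact: measurable_funB|exact: measurable_funM].
have XL : X \in Lfun la 2%:E.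
  by apply/Lfun2P; split => //; apply: le_lt_trans Xe (ltry _).
have XX : L2_inner la X X <= e ^+ 2.
  by rewrite -lee_fin -L2_innerE.
have qE : q = (fun x => q0 x + t * (X x + 2^-1 * bq x)).
  apply/funext => x; rewrite /X /bq; field; exact: lt0r_neq0.
have YL := Lfun2D XL (Lfun2Z 2^-1 bqL).
move: qq; rewrite {1 2}qE L2_inner_sqD// q00.
rewrite (L2_inner_sqD _ XL bqL) (L2_innerC _ q0) L2_innerDl ?Lfun2Z//.
rewrite L2_innerZl// b1 bb.
have h1 := Cauchy_Schwarz XL q0L; rewrite q00 mulr1 in h1.
(* Expand 0 <= |X - bq / 2|^2. *)
have h4 : L2_inner la X bq <= L2_inner la X X + 4^-1 * L2_inner eta0 b b.
  have := L2_inner_ge0 la (fun x => X x + - 2^-1 * bq x).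
  by rewrite L2_inner_sqD// bb; lra.
have y0 : 0 <= L2_inner la X X + 2 * 2^-1 * L2_inner la X bq +
    2^-1 ^+ 2 * L2_inner eta0 b b.
  by rewrite -bb -L2_inner_sqD// L2_inner_ge0.
have : `|L2_inner la X q0| <= e.
  by rewrite -ler_sqr ?nnegrE// real_normK ?num_real//; exact: le_trans h1 XX.
move: XX h4 y0.
set m := L2_inner eta0 b (fun=> 1); set B := L2_inner eta0 b b.
set xb := L2_inner la X bq; set xx := L2_inner la X X.
set xq := L2_inner la X q0 => XX h4 y0; rewrite ler_norml => /andP[xq1 xq2] qq.
pose Y := xx + 2 * 2^-1 * xb + 2^-1 ^+ 2 * B.
(* Here Y = |X + bq / 2|^2. As q and q0 are unit vectors, the expansion of |q|^2 leaves t (2 xq + m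
   + t Y) = 0, and t > 0 is cancelled. *)
have mE : m = - 2 * xq - t * Y.
  have : t * (2 * xq + m + t * Y) = 0 by move: qq; rewrite /Y; lra.
  move/eqP; rewrite mulf_eq0 (gt_eqF t0)/= => /eqP; lra.
have tY0 : 0 <= t * Y by rewrite mulr_ge0// ltW.
have tY : t * Y <= t * (2 * e ^+ 2 + 2^-1 * B).
  by rewrite ler_pM2l//; rewrite /Y; lra.
by rewrite ler_norml mE; lra.
Qed.

(** Let t decrease to 0 in [hellinger_remainder_mean]: the remainder makes e arbitrarily small, and
    the other term carries a factor t. *)
Lemma score_zero_mean (H : set (probability T R)) eta0 b :
  is_score H eta0 b -> L2_inner eta0 b (fun=> 1) = 0.
Proof.
move=> [bL [e [path [e0 _ _ Hcv]]]].
apply/normr0_eq0/le_anti; rewrite normr_ge0 andbT.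
apply/ler_addgt0Pl => k k0; rewrite addr0.
have B0 := L2_inner_ge0 eta0 b; set B := L2_inner eta0 b b in B0.
(* The tolerance k is split in two: 2 a = k / 2, and t < k / 2 / K bounds the remaining term by k /
   2. The 1 in [K] makes it positive. *)
pose a := k / 4.
have a0 : 0 < a by rewrite divr_gt0.
pose K := 2 * a ^+ 2 + 2^-1 * B + 1.
have K0 : 0 < K by rewrite /K; have := sqr_ge0 a; lra.
have /fine_cvgP[fin cv] := Hcv.
have a20 : 0 < a ^+ 2 by rewrite exprn_gt0.
have small : \forall t \near 0^'+,
    [/\ 0 < t, t < k / 2 / K & (hellinger_remainder eta0 (path t) t b <= (a ^+ 2)%:E)%E].
  near=> t; split.
  - by near: t; exact: nbhs_right_gt.
  - by near: t; apply: nbhs_right_lt; rewrite !divr_gt0.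
  - have ft : hellinger_remainder eta0 (path t) t b \is a fin_num by near: t.
    rewrite -(fineK ft) lee_fin ltW//; near: t.
    exact: cvgr_lt cv _ a20.
have [t [t0 tk tr]] := @filter_ex _ _ _ _ small.
apply: le_trans (hellinger_remainder_mean t0 (ltW a0) bL tr) _.
have : t * (2 * a ^+ 2 + 2^-1 * B) <= k / 2.
  move: tk; rewrite ltr_pdivlMr// => /ltW; apply: le_trans.
  by rewrite ler_pM2l// /K; lra.
by rewrite -/B; move: K0; rewrite /K /a; lra.
Unshelve. all: by end_near.
Qed.


End score_zero_mean.

(** * The joint law of (Z, alpha) *)

Section joint_law.
Context d (Z : measurableType d) d' (T : measurableType d') (R : realType).
Variables (mu : {sigma_finite_measure set Z -> \bar R}) (A : set T).
Variables (f : T -> Z -> R) (eta0 : probability T R) (P : probability Z R).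
Hypotheses (mA : measurable A) (f_density : cond_density mu A f).
Hypotheses (etaA : eta0 A = 1%E) (P_law : has_mixture_law mu A f eta0 P).

(** Extension by 0 off the support makes measurability and nonnegativity hold on the whole
    product. *)
Definition joint_density : Z * T -> R :=
  (fun x => f x.2 x.1) \_ (setT `*` A).

Local Notation F := joint_density.
Local Notation nu := (mu \x eta0)%E.
Local Notation m := (mixture_density A f eta0).

Lemma joint_densityE z a : F (z, a) = if a \in A then f a z else 0.
Proof.
rewrite /joint_density patchE; case: ifPn; case: ifPn => //.
- by move=> /negP aA; rewrite inE => -[_ /= Aa]; exfalso; apply: aA; rewrite inE.
- by rewrite inE => aA /negP H; exfalso; apply: H; rewrite inE.
Qed.

Lemma measurable_joint_density : measurable_fun setT F.
Proof.
apply/(measurable_restrictT _ _).1; first exact: measurableX.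
by case: f_density.
Qed.
Local Notation mF := measurable_joint_density.

Lemma joint_density_ge0 x : 0 <= F x.
Proof.
case: x => z a; rewrite joint_densityE; case: ifPn => //.
by rewrite inE => Aa; case: f_density => _ /(_ a Aa)[].
Qed.
Local Notation F0 := joint_density_ge0.

Lemma measurable_joint_density1 a : measurable_fun setT (fun z => F (z, a)).
Proof. by apply: (measurableT_comp mF). Qed.

Lemma integral_joint_density1 a : (\int[mu]_z (F (z, a))%:E = (\1_A a)%:E)%E.
Proof.
under eq_integral do rewrite joint_densityE.
rewrite indicE; have [|_] := boolP (a \in A); last by rewrite integral0.
by rewrite inE => Aa; case: f_density => _ /(_ a Aa)[].
Qed.

Lemma mixture_densityE : m = fubini_F eta0 (EFin \o F).
Proof.
apply/funext => z; rewrite /mixture_density /fubini_F [LHS]integral_mkcond.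
apply: eq_integral => a _; rewrite /= joint_densityE patchE.
by case: ifPn.
Qed.

Lemma mixture_density_ge0 z : (0 <= m z)%E.
Proof.
rewrite mixture_densityE; apply: integral_ge0 => a _.
by rewrite lee_fin F0.
Qed.

Lemma measurable_mixture_density : measurable_fun setT m.
Proof.
rewrite mixture_densityE; apply: measurable_fun_fubini_tonelli_F.
  by apply/measurable_EFinP; exact: mF.
by move=> x; rewrite lee_fin F0.
Qed.

Lemma mixture_dominated : P `<< mu.
Proof.
apply/null_content_dominatesP => B mB muB; rewrite P_law//.
rewrite -(@integral_abs_eq0 _ _ _ mu B m)//.
  by apply: eq_integral => z _; rewrite gee0_abs// mixture_density_ge0.
exact/measurable_funTS/measurable_mixture_density.
Qed.

(** The Radon-Nikodym derivative of P and the mixture density have the same integral over every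
    measurable set, hence agree almost everywhere. *)
Lemma integral_mixture (h : Z -> R) : measurable_fun setT h ->
  (forall z, 0 <= h z) ->
  (\int[P]_z (h z)%:E = \int[mu]_z ((h z)%:E * m z))%E.
Proof.
move=> mh h0.
rewrite -(Radon_Nikodym_SigmaFinite.change_of_variables mixture_dominated)//;
  [|by exact/measurable_EFinP].
have fi := Radon_Nikodym_SigmaFinite.f_integrable mixture_dominated.
have ae : ae_eq mu setT (Radon_Nikodym_SigmaFinite.f P mu) m.
  apply: integral_ae_eq => //; first exact: measurable_mixture_density.
  move=> B _ mB.
  by rewrite -Radon_Nikodym_SigmaFinite.f_integral//;
    [exact: P_law | exact: mixture_dominated].
apply: ae_eq_integral => //.
- apply: emeasurable_funM; first exact/measurable_EFinP.
  exact: measurable_int fi.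
- apply: emeasurable_funM; first exact/measurable_EFinP.
  exact: measurable_mixture_density.
- by move: ae; rewrite /ae_eq; apply: filterS => z /(_ I) -> _.
Qed.

Let measurable_weighted1 (h : Z -> R) : measurable_fun setT h ->
  measurable_fun setT (fun x : Z * T => h x.1 * F x).
Proof.
by move=> mh; apply: measurable_funM (measurable_joint_density); exact: measurableT_comp.
Qed.

Let measurable_weighted2 (k : T -> R) : measurable_fun setT k ->
  measurable_fun setT (fun x : Z * T => k x.2 * F x).
Proof.
by move=> mk; apply: measurable_funM (measurable_joint_density); exact: measurableT_comp.
Qed.

Lemma joint_marginal1 (h : Z -> R) : measurable_fun setT h ->
  (forall z, 0 <= h z) ->
  (\int[nu]_x (h x.1 * F x)%:E = \int[P]_z (h z)%:E)%E.
Proof.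
move=> mh h0; rewrite fubini_tonelli1; first last.
- by move=> x; rewrite lee_fin mulr_ge0// F0.
- by apply/measurable_EFinP; exact: measurable_weighted1.
rewrite integral_mixture//; apply: eq_integral => z _.
rewrite mixture_densityE /fubini_F /=.
under eq_integral do rewrite EFinM.
rewrite ge0_integralZl//; last by rewrite lee_fin.
- by apply/measurable_EFinP; apply: (measurableT_comp mF).
- by move=> a _; rewrite lee_fin F0.
Qed.

(** Tonelli with z integrated first: each section of the density integrates to the indicator of
    A. *)
Lemma joint_marginal2 (k : T -> R) : measurable_fun setT k ->
  (forall a, 0 <= k a) ->
  (\int[nu]_x (k x.2 * F x)%:E = \int[eta0]_a (k a * \1_A a)%:E)%E.
Proof.
move=> mk k0; rewrite fubini_tonelli2; first last.
- by move=> x; rewrite lee_fin mulr_ge0// F0.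
- by apply/measurable_EFinP; exact: measurable_weighted2.
apply: eq_integral => a _; rewrite /fubini_G /=.
under eq_integral do rewrite EFinM.
rewrite ge0_integralZl//; first by rewrite integral_joint_density1.
- by apply/measurable_EFinP; exact: measurable_joint_density1.
- by move=> z _; rewrite lee_fin F0.
- by rewrite lee_fin.
Qed.

(* Functions of z and of a as vectors of L2(mu x eta0), so that the inner
   product of [embed1 h] and [embed2 b] is E[h(Z) b(alpha)]. *)
Definition embed1 (h : Z -> R) (x : Z * T) : R := h x.1 * Num.sqrt (F x).
Definition embed2 (b : T -> R) (x : Z * T) : R := b x.2 * Num.sqrt (F x).

Definition joint_inner h b := L2_inner nu (embed1 h) (embed2 b).

Let sqrtF x : Num.sqrt (F x) ^+ 2 = F x.
Proof. by rewrite sqr_sqrtr// F0. Qed.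

Let measurable_sqrtF : measurable_fun setT (Num.sqrt \o F).
Proof.
apply: measurableT_comp mF.
by apply: continuous_measurable_fun; exact: sqrt_continuous.
Qed.

Lemma embed1_Lfun2 h : h \in Lfun P 2%:E -> embed1 h \in Lfun nu 2%:E.
Proof.
move=> /Lfun2P[mh hi]; apply/Lfun2P; split.
  by apply: measurable_funM => //; exact: measurableT_comp.
rewrite /embed1; under eq_integral do rewrite exprMn sqrtF.
rewrite (joint_marginal1 (h := fun z => h z ^+ 2))//; first exact: measurable_funX.
by move=> z; exact: sqr_ge0.
Qed.

Lemma embed2_integral b : measurable_fun setT b ->
  (\int[nu]_x (embed2 b x ^+ 2)%:E <= \int[eta0]_a (b a ^+ 2)%:E)%E.
Proof.
move=> mb; rewrite /embed2; under eq_integral do rewrite exprMn sqrtF.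
rewrite (joint_marginal2 (k := fun a => b a ^+ 2)); [|exact: measurable_funX|
  by move=> a; exact: sqr_ge0].
apply: ge0_le_integral => //.
- by move=> a _; rewrite lee_fin mulr_ge0 ?sqr_ge0.
- by apply/measurable_EFinP/measurable_funM => //; exact: measurable_funX.
- by apply/measurable_EFinP; exact: measurable_funX.
- by move=> a _; rewrite lee_fin ler_piMr ?sqr_ge0// indicE lern1 leq_b1.
Qed.

Lemma embed2_Lfun2 b : b \in Lfun eta0 2%:E -> embed2 b \in Lfun nu 2%:E.
Proof.
move=> /Lfun2P[mb bi]; apply/Lfun2P; split; last first.
  exact: le_lt_trans (embed2_integral mb) bi.
by apply: measurable_funM => //; exact: measurableT_comp.
Qed.

(** Cauchy-Schwarz in the product space, followed by the two marginals. It makes h |->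
    E[h(Z) b(alpha)] bounded on L2(P). *)
Lemma joint_inner_CS h b : h \in Lfun P 2%:E -> b \in Lfun eta0 2%:E ->
  joint_inner h b ^+ 2 <= L2_inner eta0 b b * L2_inner P h h.
Proof.
move=> hL bL.
apply: (le_trans (Cauchy_Schwarz (embed1_Lfun2 hL) (embed2_Lfun2 bL))).
rewrite mulrC ler_pM ?L2_inner_ge0//;
  rewrite -lee_fin -!L2_innerE ?embed1_Lfun2 ?embed2_Lfun2//.
  under eq_integral do rewrite -expr2.
  under [leRHS]eq_integral do rewrite -expr2.
  by apply: embed2_integral; exact: Lfun2_measurable bL.
under eq_integral do rewrite -expr2 exprMn sqrtF.
rewrite (joint_marginal1 (h := fun z => h z ^+ 2)); [|
  by apply: measurable_funX; exact: Lfun2_measurable hL|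
  by move=> z; exact: sqr_ge0].
exact: lexx.
Qed.

Lemma joint_innerDl h h' c b :
  h \in Lfun P 2%:E -> h' \in Lfun P 2%:E -> b \in Lfun eta0 2%:E ->
  joint_inner (fun z => h z + c * h' z) b =
  joint_inner h b + c * joint_inner h' b.
Proof.
move=> hL hL' bL; rewrite /joint_inner.
have -> : embed1 (fun z => h z + c * h' z) =
    (fun x => embed1 h x + c * embed1 h' x).
  by apply/funext => x; rewrite /embed1; ring.
have iL := embed1_Lfun2 hL; have iL' := embed1_Lfun2 hL'.
have jL := embed2_Lfun2 bL.
by rewrite L2_innerDl ?Lfun2Z// L2_innerZl.
Qed.

Lemma joint_innerDr h b c b' :
  h \in Lfun P 2%:E -> b \in Lfun eta0 2%:E -> b' \in Lfun eta0 2%:E ->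
  joint_inner h (fun a => b a + c * b' a) =
  joint_inner h b + c * joint_inner h b'.
Proof.
move=> hL bL bL'; rewrite /joint_inner.
have -> : embed2 (fun a => b a + c * b' a) =
    (fun x => embed2 b x + c * embed2 b' x).
  by apply/funext => x; rewrite /embed2; ring.
have iL := embed1_Lfun2 hL.
have jL := embed2_Lfun2 bL; have jL' := embed2_Lfun2 bL'.
rewrite L2_innerC L2_innerDl ?Lfun2Z// L2_innerZl//.
by rewrite L2_innerC (L2_innerC _ (embed2 b')).
Qed.

Lemma adjoint_exists b : b \in Lfun eta0 2%:E ->
  exists2 g, g \in Lfun P 2%:E &
    forall h, h \in Lfun P 2%:E -> L2_inner P g h = joint_inner h b.
Proof.
move=> bL; pose G h x := h \in Lfun P 2%:E /\ x = joint_inner h b.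
have linG : linear_graph P G.
  split.
  - by move=> h x [].
  - split; first exact: Lfun2_0.
    rewrite /joint_inner /embed1 /L2_inner.
    under eq_Rintegral do rewrite mul0r mul0r.
    by rewrite /Rintegral integral0.
  - move=> c h x h' x' [hL ->] [hL' ->]; split; first exact/Lfun2D/Lfun2Z.
    by rewrite joint_innerDl.
have bndG h x : G h x -> x ^+ 2 <= L2_inner eta0 b b * L2_inner P h h.
  by move=> [hL ->]; exact: joint_inner_CS.
have [g gL [_ gE]] := bounded_graph_Riesz (L2_inner_ge0 eta0 b) linG bndG.
by exists g => // h hL; exact: gE.
Qed.

(** Testing the adjoint relation on the indicator of B gives the defining property of
    E[b(alpha) | Z]. *)
Lemma adjoint_score_operator b g :
  b \in Lfun eta0 2%:E -> g \in Lfun P 2%:E ->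
  (forall h, h \in Lfun P 2%:E -> L2_inner P g h = joint_inner h b) ->
  is_score_operator mu A f eta0 P b g.
Proof.
move=> bL gL gE; split.
  by apply: Lfun_subset12 => //; rewrite fin_num_measure.
move=> B mB.
have BL : \1_B \in Lfun P 2%:E.
  apply: (@Lfun2_le _ _ _ _ _ (fun=> 1)) => //; first exact: Lfun_cst.
  by move=> z; rewrite indicE normr_nat normr1 lern1 leq_b1.
transitivity (\int[P]_z (g z * \1_B z)%:E)%E.
  rewrite integral_mkcond; apply: eq_integral => z _.
  by rewrite patchE indicE; case: ifPn => _; rewrite ?mulr1 ?mulr0.
rewrite L2_innerE// gE// /joint_inner -L2_innerE ?embed1_Lfun2 ?embed2_Lfun2//.
rewrite [RHS]integral_mkcond; apply: eq_integral => -[z a] _.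
rewrite patchE /embed1 /embed2 /= mulrACA -expr2 sqrtF joint_densityE indicE.
have -> : ((z, a) \in B `*` A) = (z \in B) && (a \in A).
  by apply/idP/andP; rewrite !inE.
by case: (z \in B); case: (a \in A);
  rewrite ?mul1r ?mulr0 ?mul0r// mulrC.
Qed.

(** * The conditional mean of s(Z) given alpha *)

Lemma cond_meanE s a :
  cond_mean mu A f s a = fine (\int[mu]_z (s z * F (z, a))%:E).
Proof.
rewrite /cond_mean patchE; case: ifPn => aA.
  by apply: eq_Rintegral => z _; rewrite joint_densityE aA.
under eq_integral do rewrite joint_densityE (negbTE aA) mulr0.
by rewrite integral0.
Qed.

Lemma measurable_cond_mean s : measurable_fun setT s ->
  measurable_fun setT (cond_mean mu A f s).
Proof.
move=> ms; rewrite (_ : cond_mean _ _ _ _ = fun a =>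
    fine (\int[mu]_z (s z * F (z, a))%:E)); last first.
  by apply/funext => a; rewrite cond_meanE.
have mw := measurable_weighted1 ms.
suff mi : measurable_fun setT (fun a => (\int[mu]_z (s z * F (z, a))%:E)%E).
  exact: measurableT_comp.
pose w (x : Z * T) := (s x.1 * F x)%:E.
have mwE : measurable_fun setT w by exact/measurable_EFinP.
have mp : measurable_fun setT (fubini_G mu w^\+%E).
  by apply: measurable_fun_fubini_tonelli_G => //; exact: measurable_funepos.
have mn : measurable_fun setT (fubini_G mu w^\-%E).
  by apply: measurable_fun_fubini_tonelli_G => //; exact: measurable_funeneg.
(* Sections need not be integrable for every a, so Tonelli is applied to the positive and negative
   parts, whose difference is the integral by definition. *)
rewrite (_ : (fun a => _) = (fubini_G mu w^\+%E \- fubini_G mu w^\-%E)%E).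
  exact: emeasurable_funB.
apply/funext => a; rewrite [LHS]integralE.
by congr (_ - _)%E; apply: eq_integral => z _; rewrite ?funeposE ?funenegE.
Qed.

(** This is E[s(Z)^2 | alpha = a], extended-valued because s in L2(P) makes it finite only for
    almost every a. *)
Let cond_sq s a : \bar R := (\int[mu]_z (s z ^+ 2 * F (z, a))%:E)%E.

Let cond_sq_ge0 s a : (0 <= cond_sq s a)%E.
Proof.
by apply: integral_ge0 => z _; rewrite lee_fin mulr_ge0 ?sqr_ge0// F0.
Qed.

Let weighted_section_Lfun2 s a : measurable_fun setT s ->
  (cond_sq s a < +oo)%E ->
  (fun z => s z * Num.sqrt (F (z, a))) \in Lfun mu 2%:E.
Proof.
move=> ms fin; apply/Lfun2P; split.
  apply: measurable_funM => //.
  by apply: (measurableT_comp measurable_sqrtF).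
by under eq_integral do rewrite exprMn sqrtF.
Qed.

Let sqrt_section_Lfun2 a : (fun z => Num.sqrt (F (z, a))) \in Lfun mu 2%:E.
Proof.
have := @weighted_section_Lfun2 (fun=> 1) a.
under [fun z => 1 * _]eq_fun do rewrite mul1r.
apply; first exact: measurable_cst.
rewrite /cond_sq; under eq_integral do rewrite expr1n mul1r.
by rewrite integral_joint_density1 ltry.
Qed.

Let cond_meanE_inner s a : cond_mean mu A f s a =
  L2_inner mu (fun z => s z * Num.sqrt (F (z, a))) (fun z => Num.sqrt (F (z, a))).
Proof.
rewrite cond_meanE; apply: eq_Rintegral => z _.
by rewrite -mulrA -expr2 sqrtF.
Qed.

(** Conditional Jensen, by Cauchy-Schwarz after factoring s F as (s sqrt F) (sqrt F), where sqrt F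
    has norm at most 1. *)
Let cond_mean_sq_le s a : measurable_fun setT s ->
  ((cond_mean mu A f s a ^+ 2)%:E <= cond_sq s a)%E.
Proof.
move=> ms; have [fin|] := ltP (cond_sq s a) +oo%E; last first.
  by rewrite leye_eq => /eqP ->; rewrite leey.
have sL := weighted_section_Lfun2 ms fin; have qL := sqrt_section_Lfun2 a.
have -> : cond_sq s a = (L2_inner mu (fun z => s z * Num.sqrt (F (z, a)))
   (fun z => s z * Num.sqrt (F (z, a))))%:E.
  rewrite -L2_innerE//; apply: eq_integral => z _.
  by rewrite -expr2 exprMn sqrtF.
rewrite lee_fin cond_meanE_inner; apply: (le_trans (Cauchy_Schwarz sL qL)).
rewrite ler_piMr ?L2_inner_ge0// -lee_fin -L2_innerE//.
under eq_integral do rewrite -expr2 sqrtF.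
by rewrite integral_joint_density1 lee_fin indicE lern1 leq_b1.
Qed.

Let cond_sq_integral s : measurable_fun setT s ->
  (\int[eta0]_a cond_sq s a = \int[P]_z (s z ^+ 2)%:E)%E.
Proof.
move=> ms; rewrite -joint_marginal1; [|exact: measurable_funX|
  by move=> z; exact: sqr_ge0].
rewrite fubini_tonelli2//.
- apply/measurable_EFinP; apply: (@measurable_weighted1 (fun z => s z ^+ 2)).
  exact: measurable_funX.
- by move=> x; rewrite lee_fin mulr_ge0 ?sqr_ge0// F0.
Qed.

Let measurable_cond_sq s : measurable_fun setT s ->
  measurable_fun setT (cond_sq s).
Proof.
move=> ms; apply: (@measurable_fun_fubini_tonelli_G _ _ _ _ _ mu
  (fun x => (s x.1 ^+ 2 * F x)%:E)).
- apply/measurable_EFinP; apply: (@measurable_weighted1 (fun z => s z ^+ 2)).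
  exact: measurable_funX.
- by move=> x; rewrite lee_fin mulr_ge0 ?sqr_ge0// F0.
Qed.

Lemma cond_mean_Lfun2 s : s \in Lfun P 2%:E ->
  cond_mean mu A f s \in Lfun eta0 2%:E.
Proof.
move=> /Lfun2P[ms si]; have mc := measurable_cond_mean ms.
apply/Lfun2P; split => //; apply: le_lt_trans si.
rewrite -cond_sq_integral//; apply: ge0_le_integral => //.
- by move=> a _; rewrite lee_fin sqr_ge0.
- by apply/measurable_EFinP; exact: measurable_funX.
- exact: measurable_cond_sq.
- by move=> a _; exact: cond_mean_sq_le.
Qed.

Lemma joint_inner_cond_mean s b :
  s \in Lfun P 2%:E -> b \in Lfun eta0 2%:E ->
  joint_inner s b = L2_inner eta0 (cond_mean mu A f s) b.
Proof.
move=> sL bL; have /Lfun2P[ms si] := sL; have mb := Lfun2_measurable bL.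
have mc := measurable_cond_mean ms.
have iL := embed1_Lfun2 sL; have jL := embed2_Lfun2 bL.
have ij := Lfun2_mul_integrable iL jL.
apply: EFin_inj; rewrite /joint_inner -!L2_innerE ?cond_mean_Lfun2//.
rewrite -integral21_prod_meas1//.
apply: ae_eq_integral => //.
- exact: measurable_fubini_G ij.
- by apply/measurable_EFinP; apply: (measurable_funM mc mb).
(* Where the conditional second moment is finite, the section of s F is integrable, so b(a) can be
   pulled out of the inner integral. *)
have : eta0.-integrable setT (cond_sq s).
  apply/integrableP; split; first by apply: measurable_cond_sq.
  under eq_integral do rewrite gee0_abs ?cond_sq_ge0//.
  by rewrite cond_sq_integral.
move=> /(integrable_ae measurableT); rewrite /ae_eq.
apply: filterS => a /(_ I) fin _.
rewrite /fubini_G /embed1 /embed2 /= cond_meanE_inner.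
have wL : (fun z => s z * Num.sqrt (F (z, a))) \in Lfun mu 2%:E.
  by apply: weighted_section_Lfun2 => //; rewrite ltey_eq fin.
have qL := sqrt_section_Lfun2 a.
rewrite [in RHS]mulrC EFinM -(L2_innerE wL qL).
rewrite -integralZl//; last exact: Lfun2_mul_integrable.
by apply: eq_integral => z _; rewrite -EFinM; congr EFin; ring.
Qed.

(** The conditional mean of 1 is the indicator of A, which equals 1 almost surely under [eta0]. Thus
    recentring s shifts its pairing with b by a multiple of the mean of b. *)
Lemma joint_inner1 b : b \in Lfun eta0 2%:E ->
  joint_inner (fun=> 1) b = L2_inner eta0 b (fun=> 1).
Proof.
move=> bL; have mb := Lfun2_measurable bL.
rewrite joint_inner_cond_mean//; last exact: Lfun_cst.
have cE a : cond_mean mu A f (fun=> 1) a = \1_A a.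
  rewrite cond_meanE; under eq_integral do rewrite mul1r.
  by rewrite integral_joint_density1.
rewrite /L2_inner /Rintegral; congr fine.
apply: ae_eq_integral => //.
- apply/measurable_EFinP/measurable_funM => //.
  by apply: measurable_cond_mean; exact: measurable_cst.
- by apply/measurable_EFinP/measurable_funM => //; exact: measurable_cst.
exists (~` A); split; first exact: measurableC.
- by have := probability_setC eta0 mA; rewrite etaA subee.
- move=> a /= + Aa; apply => _; rewrite cE indicE mem_set//.
  by rewrite mul1r mulr1.
Qed.

End joint_law.

(** * The efficiency bound *)

Section efficiency.
Context d (Z : measurableType d) d' (T : measurableType d') (R : realType).
Variables (mu : {sigma_finite_measure set Z -> \bar R}) (A : set T).
Variables (f : T -> Z -> R) (H : set (probability T R)).
Variables (eta0 : probability T R) (P : probability Z R) (r : T -> R).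
Hypotheses (mA : measurable A) (f_density : cond_density mu A f).
Hypotheses (etaA : eta0 A = 1%E) (P_law : has_mixture_law mu A f eta0 P).
Hypotheses (rL : r \in Lfun eta0 2%:E)
  (bound_fin : (efficiency_bound mu A f H eta0 P r < +oo)%E).

Lemma tangent_space_subspace : is_L2_subspace eta0 (tangent_space H eta0).
Proof. by apply: lin_span_subspace => b []. Qed.

Lemma tangent_space_zero_mean b : tangent_space H eta0 b ->
  L2_inner eta0 b (fun=> 1) = 0.
Proof.
move=> [n [c [s [Ss ->]]]].
have one : (fun=> 1) \in Lfun eta0 2%:E by exact: Lfun_cst.
elim: n c s Ss => [|n ih] c s Ss.
  rewrite /L2_inner; under eq_Rintegral do rewrite big_ord0 mul0r.
  by rewrite /Rintegral integral0.
under [fun x => \sum_(i < _) _]eq_fun do rewrite big_ord_recl.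
have sL i : s i \in Lfun eta0 2%:E by have [] := Ss i.
have [spanL _ _] := tangent_space_subspace.
rewrite L2_innerDl ?Lfun2Z//.
  rewrite L2_innerZl// (score_zero_mean (Ss ord0)) mulr0 add0r.
  exact: (ih (fun i => c (lift ord0 i)) (fun i => s (lift ord0 i))).
apply: spanL; exists n, (fun i => c (lift ord0 i)), (fun i => s (lift ord0 i)).
by split.
Qed.

Lemma efficiency_bound_inner : exists2 C : R, 0 <= C & forall b g,
  tangent_space H eta0 b -> g \in Lfun P 2%:E ->
  is_score_operator mu A f eta0 P b g ->
  L2_inner eta0 r b ^+ 2 <= C * L2_inner P g g.
Proof.
have [TL T0 _] := tangent_space_subspace.
set E := efficiency_bound mu A f H eta0 P r.
(* The zero tangent contributes the quotient 0, so the supremum is not -oo and its upper bound makes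
   it a real number. *)
have E0 : (0 <= E)%E.
  have zL := TL _ T0.
  have [g gL gE] := adjoint_exists mA f_density P_law zL.
  apply: ereal_sup_ubound; exists (fun=> 0), g; split => //.
    exact: adjoint_score_operator.
  rewrite expectation_inner// L2_innerC.
  rewrite /L2_inner; under eq_Rintegral do rewrite mul0r.
  by rewrite /Rintegral integral0 -EFin_expe expr0n mul0e.
have Efin : E \is a fin_num by rewrite ge0_fin_numE.
exists (fine E); first exact: fine_ge0.
move=> b g Tb gL gE; have bL := TL _ Tb.
have : (('E_eta0[(r \* b)%R] ^+ 2 / 'E_P[(g \* g)%R])%E <= E)%E.
  by apply: ereal_sup_ubound; exists b, g.
rewrite !expectation_inner//.
set x := L2_inner eta0 r b; have n0 := L2_inner_ge0 P g; move: n0.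
set n := L2_inner P g g => n0.
(* If the information n vanishes, a nonzero derivative x would give the quotient +oo and contradict
   the finite bound; so x = 0. *)
have [nz|nz] := eqVneq n 0; last first.
  have np : 0 < n by rewrite lt_neqAle eq_sym nz.
  by rewrite inver (negbTE nz) -(fineK Efin) -EFin_expe -EFinM lee_fin
    ler_pdivrMr.
have [x0 _|x0] := eqVneq x 0; first by rewrite x0 nz expr0n mulr0.
rewrite nz inve0 -EFin_expe gt0_muley ?lte_fin ?exprn_even_gt0//.
by rewrite leye_eq => /eqP Ey; rewrite Ey in Efin.
Qed.

Lemma efficient_moment : exists2 s, L2_zero_mean P s &
  forall b, tangent_space H eta0 b ->
    L2_inner eta0 r b = L2_inner eta0 (cond_mean mu A f s) b.
Proof.
have [TL T0 Tl] := tangent_space_subspace.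
have [C C0 bndC] := efficiency_bound_inner.
pose adjoint b g := forall h, h \in Lfun P 2%:E ->
  L2_inner P g h = joint_inner mu A f eta0 h b.
(* The graph of S b |-> E[r b]. Tangents with the same image under S are not identified here; the
   efficiency bound forces them to have the same derivative. *)
pose G g x := exists b, [/\ tangent_space H eta0 b, g \in Lfun P 2%:E,
  adjoint b g & x = L2_inner eta0 r b].
have linG : linear_graph P G.
  split.
  - by move=> g x [b []].
  - exists (fun=> 0); split => //; first exact: Lfun2_0.
      move=> h hL; rewrite /joint_inner /embed2 /L2_inner.
      under eq_Rintegral do rewrite mul0r.
      under [RHS]eq_Rintegral do rewrite mul0r mulr0.
      by rewrite /Rintegral !integral0.
    rewrite /L2_inner; under eq_Rintegral do rewrite mulr0.
    by rewrite /Rintegral integral0.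
  - move=> c g x g' x' [b [Tb gL gE ->]] [b' [Tb' gL' gE' ->]].
    have bL := TL _ Tb; have bL' := TL _ Tb'.
    exists (fun a => b a + c * b' a); split.
    + exact: Tl.
    + exact/Lfun2D/Lfun2Z.
    + move=> h hL; rewrite L2_innerDl ?Lfun2Z// L2_innerZl// gE// gE'//.
      by rewrite (joint_innerDr mA f_density P_law).
    + rewrite [RHS]L2_innerC L2_innerDl ?Lfun2Z// L2_innerZl//.
      by rewrite (L2_innerC _ b) (L2_innerC _ b').
have bndG g x : G g x -> x ^+ 2 <= C * L2_inner P g g.
  move=> [b [Tb gL gE ->]]; apply: bndC => //.
  by apply: adjoint_score_operator => //; exact: TL.
have [s sL [_ sE]] := bounded_graph_Riesz C0 linG bndG.
have one : (fun=> 1) \in Lfun P 2%:E by exact: Lfun_cst.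
pose c := L2_inner P s (fun=> 1).
(* Recentring by the mean c, kept in the form s + c' * 1 to match the linearity lemmas. *)
have s0L : (fun z => s z + - c * 1) \in Lfun P 2%:E by exact/Lfun2D/Lfun2Z.
exists (fun z => s z + - c * 1).
  split => //.
  have -> : (fun z => s z + - c * 1) = (fun z => s z + - c * 1) \* (fun=> 1).
    by apply/funext => z /=; rewrite [RHS]mulr1.
  rewrite expectation_inner// L2_innerDl ?Lfun2Z// L2_innerZl//.
  have -> : L2_inner P (fun=> 1) (fun=> 1) = 1.
    rewrite /L2_inner mulr1 Rintegral_cst// mul1r.
    by have /= -> := @probability_setT _ _ _ P.
  by rewrite mulr1 -/c subrr.
move=> b Tb; have bL := TL _ Tb.
have [g gL gE] := adjoint_exists mA f_density P_law bL.
(* Moving back to E[s(Z) b(alpha)], the recentring term is -c times the mean of b, which is 0 for a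
   tangent. *)
rewrite -(joint_inner_cond_mean mA f_density P_law s0L bL).
rewrite (joint_innerDl mA f_density P_law)//.
rewrite (joint_inner1 mA f_density etaA P_law bL) tangent_space_zero_mean//.
rewrite mulr0 addr0 -gE// (L2_innerC P).
by apply/esym/sE; exists b.
Qed.

End efficiency.

Theorem lemma6p1 (R : realType) (d : measure_display) (Z : measurableType d)
    (mu : {sigma_finite_measure set Z -> \bar R})
    (d_alpha : nat) (A : set (d_alpha.-tuple R))
    (f : d_alpha.-tuple R -> Z -> R)
    (H : set (probability (d_alpha.-tuple R) R))
    (eta0 : probability (d_alpha.-tuple R) R)
    (P : probability Z R)
    (r : d_alpha.-tuple R -> R)
    (mA : measurable A)
    (f_density : cond_density mu A f)
    (H_supp : forall eta : probability (d_alpha.-tuple R) R,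
       H eta -> eta A = 1%E)
    (H_eta0 : H eta0)
    (P_law : has_mixture_law mu A f eta0 P)
    (r_L2 : r \in Lfun eta0 2%:E)
    (r_reg : regularly_identified mu A f H eta0 P r) :
  exists2 s : Z -> R, L2_zero_mean P s &
    exists p : d_alpha.-tuple R -> R,
      is_L2_proj eta0 (closed_tangent_space H eta0) r p /\
      is_L2_proj eta0 (closed_tangent_space H eta0) (cond_mean mu A f s) p.
Proof.
case: r_reg => _ bound_fin.
have [s s0 sE] := efficient_moment mA f_density (H_supp _ H_eta0) P_law r_L2
  bound_fin.
have [TL _ _] := tangent_space_subspace H eta0.
have [p rp] := L2_proj_exists (tangent_space_subspace H eta0) r_L2.
exists s => //; exists p; split => //.
apply: L2_proj_eq rp => //.
by apply: (cond_mean_Lfun2 mA f_density P_law); case: s0.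
Qed.
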